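(* For every integer $n\geq 2$, $$B_n^+(s,t)=sB_{n-1}^+(s,t)+tB_{n-1}^-(s,t)+st\,DB_{n-1}(s,t),\qquad B_n^-(s,t)=sB_{n-1}^-(s,t)+tB_{n-1}^+(s,t)+st\,DB_{n-1}(s,t),$$ where $D=\frac{\partial}{\partial s}+\frac{\partial}{\partial t}$.
   Context: $\mathfrak{B}_n$ is the group of signed permutations: bijections $\pi$ of $\{\pm1,\dots,\pm n\}$ with $\pi(-i)=-\pi(i)$; write $\pi_i=\pi(i)$ and $\pi_0=0$. $\mathsf{inv}_B(\pi)=|\{1\le i<j\le n:\pi_i>\pi_j\}|+|\{1\le i<j\le n:-\pi_i>\pi_j\}|+|\{i\in[n]:\pi_i<0\}|$; $\mathfrak{B}_n^+$ is the set of $\pi$ with $\mathsf{inv}_B(\pi)$ even, $\mathfrak{B}_n^-=\mathfrak{B}_n\setminus\mathfrak{B}_n^+$. $\mathsf{des}_B(\pi)=|\{i\in\{0,\dots,n-1\}:\pi_i>\pi_{i+1}\}|$, $\mathsf{asc}_B(\pi)=|\{i\in\{0,\dots,n-1\}:\pi_i<\pi_{i+1}\}|$. $B_n(s,t)=\sum_{\pi\in\mathfrak{B}_n}t^{\mathsf{des}_B(\pi)}s^{\mathsf{asc}_B(\pi)}$, $B_n^{\pm}(s,t)=\sum_{\pi\in\mathfrak{B}_n^{\pm}}t^{\mathsf{des}_B(\pi)}s^{\mathsf{asc}_B(\pi)}$. *)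

(* Defs.v *)
From HB Require Import structures.
From mathcomp Require Import all_boot all_order all_algebra all_fingroup.
From mathcomp Require Import mpoly.

Set Implicit Arguments.
Unset Strict Implicit.
Unset Printing Implicit Defensive.

Import Order.TTheory GRing.Theory Num.Theory.
Local Open Scope ring_scope.

(* The set {±1, ..., ±n}: (i, false) stands for i + 1, (i, true) for -(i + 1). *)
Definition letter (n : nat) : finType := ('I_n * bool)%type.

Definition lneg (n : nat) (x : letter n) : letter n := (x.1, ~~ x.2).

Definition lval (n : nat) (x : letter n) : int :=
  if x.2 then - (x.1.+1)%:Z else (x.1.+1)%:Z.

Definition signed_perms (n : nat) : {set {perm letter n}} :=
  [set p : {perm letter n} | [forall x, p (lneg x) == lneg (p x)]].

(* pi_i for 0 <= i <= n, with pi_0 = 0. *)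
Definition entry (n : nat) (p : {perm letter n}) (i : 'I_n.+1) : int :=
  if unlift ord0 i is Some j then lval (p (j, false)) else 0.

(* pi_(i+1): the indices 1, ..., n are shifted to 'I_n. *)
Definition entry1 (n : nat) (p : {perm letter n}) (i : 'I_n) : int :=
  entry p (lift ord0 i).

(* pi_i for 0 <= i <= n - 1. *)
Definition entry0 (n : nat) (p : {perm letter n}) (i : 'I_n) : int :=
  entry p (widen_ord (leqnSn n) i).

Definition inv_B (n : nat) (p : {perm letter n}) : nat :=
  (#|[set ij : 'I_n * 'I_n |
       (ij.1 < ij.2)%N && (entry1 p ij.1 > entry1 p ij.2)%R]|
   + #|[set ij : 'I_n * 'I_n |
       (ij.1 < ij.2)%N && (- entry1 p ij.1 > entry1 p ij.2)%R]|
   + #|[set i : 'I_n | (entry1 p i < 0)%R]|)%N.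

Definition des_B (n : nat) (p : {perm letter n}) : nat :=
  #|[set i : 'I_n | entry0 p i > entry1 p i]|.

Definition asc_B (n : nat) (p : {perm letter n}) : nat :=
  #|[set i : 'I_n | entry0 p i < entry1 p i]|.

Definition signed_perms_plus (n : nat) : {set {perm letter n}} :=
  [set p in signed_perms n | ~~ odd (inv_B p)].

Definition signed_perms_minus (n : nat) : {set {perm letter n}} :=
  signed_perms n :\: signed_perms_plus n.

Definition idx_s : 'I_2 := ord0.
Definition idx_t : 'I_2 := ord_max.
Definition var_s : {mpoly int[2]} := 'X_idx_s.
Definition var_t : {mpoly int[2]} := 'X_idx_t.

Definition eulerian_gf (n : nat) (A : {set {perm letter n}}) : {mpoly int[2]} :=
  \sum_(p in A) var_t ^+ des_B p * var_s ^+ asc_B p.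

Definition B_poly (n : nat) : {mpoly int[2]} :=
  eulerian_gf (signed_perms n).
Definition B_plus (n : nat) : {mpoly int[2]} :=
  eulerian_gf (signed_perms_plus n).
Definition B_minus (n : nat) : {mpoly int[2]} :=
  eulerian_gf (signed_perms_minus n).

Definition D_st (f : {mpoly int[2]}) : {mpoly int[2]} :=
  mderiv idx_s f + mderiv idx_t f.

(* Main.v *)
Require Import Defs.
From mathcomp Require Import all_boot all_order all_algebra all_fingroup.
From mathcomp Require Import mpoly ring zify.
Set Implicit Arguments.
Unset Strict Implicit.
Unset Printing Implicit Defensive.
Import Order.TTheory GRing.Theory Num.Theory.
Local Open Scope ring_scope.

(* Every signed permutation of size n + 1 arises in a unique way by inserting
   n + 1 or -(n + 1) into a signed permutation p of size n.  With m letters to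
   the right of the insertion point, inv_B changes parity by m for n + 1 and by
   m + 1 for -(n + 1).  Inserting at the end adds an ascent and keeps the parity,
   or adds a descent and flips it: this gives the terms in s and t.  Inserting
   anywhere else breaks up one ascent or descent and creates one of each, whatever
   the sign; exactly one of the two signs gives the wanted parity, so these
   insertions contribute st D (t^des s^asc) to both B^+ and B^-. *)

(** * Values and entries of signed permutations *)

Lemma signed_permP n (p : {perm letter n}) :
  reflect (forall i c, p (i, ~~ c) = lneg (p (i, c))) (p \in signed_perms n).
Proof.
rewrite inE; apply: (iffP forallP) => [H i c | H [i c]].
  exact: (eqP (H (i, c))).
by rewrite /lneg /= H.
Qed.

Lemma lval_inj n : injective (@lval n).
Proof.
move=> [[i hi] b] [[j hj] c]; rewrite /lval /= => H.
have [-> eij]: b = c /\ i = j by case: b H; case: c => /=; lia.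
by move: eij hi hj => -> hi hj; congr (_, _); apply: val_inj.
Qed.

Lemma lval_bound n (x : letter n) : - n.+1%:Z < lval x < n.+1%:Z.
Proof. by case: x => [[i hi] b]; rewrite /lval /=; case: b; lia. Qed.

Lemma lval_lift_max n (x : letter n) :
  lval ((lift ord_max x.1, x.2) : letter n.+1) = lval x.
Proof. by rewrite /lval /= /bump leqNgt ltn_ord. Qed.

(** Both bounds are strict, so an inserted n + 1 or -(n + 1) is extreme among all entries, including
    the initial 0. *)
Lemma entry_bound n (p : {perm letter n}) i : - n.+1%:Z < entry p i < n.+1%:Z.
Proof.
rewrite /entry; case: (unlift _ _) => [j|]; last by lia.
exact: lval_bound.
Qed.

Lemma entry1E n (p : {perm letter n}) j : entry1 p j = lval (p (j, false)).
Proof. by rewrite /entry1 /entry liftK. Qed.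

Lemma entry_ord0 n (p : {perm letter n}) (i : 'I_n.+1) :
  i = 0%N :> nat -> entry p i = 0.
Proof. by move=> i0; rewrite /entry (_ : i = ord0) ?unlift_none //; apply: val_inj. Qed.

Lemma entryS n (p : {perm letter n}) (i : 'I_n.+1) (j : 'I_n) :
  i = j.+1 :> nat -> entry p i = entry1 p j.
Proof. by move=> ij; congr (entry p _); apply: val_inj. Qed.

(** Makes every position either a descent or an ascent. No letter has value 0, and distinct
    positions carry distinct letters. *)
Lemma entry0_neq_entry1 n (p : {perm letter n}) (j : 'I_n) :
  entry0 p j != entry1 p j.
Proof.
rewrite entry1E /entry0; case: j => [[|j] hj].
  rewrite entry_ord0 // /lval; case: (p _) => i b /=; case: b; lia.
rewrite (@entryS _ _ _ (Ordinal (ltnW hj))) // entry1E.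
by rewrite (inj_eq (@lval_inj n)) (inj_eq perm_inj) xpair_eqE -val_eqE /=; lia.
Qed.

(** * Insertion of a largest letter as a bijection *)

(* [insert p k b] puts n + 1, or -(n + 1) if [b], in position [k] (counted from 0). *)
Definition insert_fun n (p : {perm letter n}) (k : 'I_n.+1) (b : bool)
    (x : letter n.+1) : letter n.+1 :=
  if unlift k x.1 is Some j
  then (lift ord_max (p (j, x.2)).1, (p (j, x.2)).2)
  else (ord_max, b (+) x.2).

Lemma insert_fun_inj n (p : {perm letter n}) k b : injective (insert_fun p k b).
Proof.
move=> [i c] [i' c']; rewrite /insert_fun /=.
case: (unliftP k i) => [j|] ->; case: (unliftP k i') => [j'|] -> /pair_equal_spec[].
- move=> /lift_inj e1 e2.
  have /perm_inj[-> ->] // : p (j, c) = p (j', c').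
  by apply/eqP; rewrite -pair_eqE /= /pair_eq e1 e2 !eqxx.
- by move=> /eqP; rewrite eq_sym (negPf (neq_lift _ _)).
- by move=> /eqP; rewrite (negPf (neq_lift _ _)).
- by move=> _ /addbI ->.
Qed.

Definition insert n (p : {perm letter n}) k b : {perm letter n.+1} :=
  perm (@insert_fun_inj n p k b).

Lemma insert_lift n (p : {perm letter n}) k b j c :
  insert p k b (lift k j, c) = (lift ord_max (p (j, c)).1, (p (j, c)).2).
Proof. by rewrite permE /insert_fun /= liftK. Qed.

Lemma insert_at n (p : {perm letter n}) k b c :
  insert p k b (k, c) = (ord_max, b (+) c).
Proof. by rewrite permE /insert_fun /= unlift_none. Qed.

Lemma insert_signed n (p : {perm letter n}) k b :
  p \in signed_perms n -> insert p k b \in signed_perms n.+1.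
Proof.
move=> /signed_permP sp; apply/signed_permP => i c.
case: (unliftP k i) => [j|] ->; first by rewrite !insert_lift sp.
by rewrite !insert_at addbN.
Qed.

Lemma insert_inj n :
  injective (fun x : {perm letter n} * 'I_n.+1 * bool => insert x.1.1 x.1.2 x.2).
Proof.
move=> [[p k] b] [[p' k'] b'] /= e.
have ek : k = k'.
  (* The sign [b' (+) b] is chosen so that the image is [(ord_max, b)], which [insert p k b] also
     takes at [(k, false)]. *)
  have := insert_at p' k' b' (b' (+) b); rewrite -e addKb.
  rewrite -[in RHS](addbF b) -(insert_at p k).
  by move/perm_inj => [].
move: e; rewrite -{}ek => {k'} e.
have := insert_at p k b false; rewrite e insert_at !addbF => -[eb].
congr (_, _, _) => //; apply/permP => -[j c].
have := insert_lift p k b j c; rewrite e insert_lift => /pair_equal_spec[/lift_inj e1 e2].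
by apply/esym/eqP; rewrite -pair_eqE /= /pair_eq e1 e2 !eqxx.
Qed.

Lemma insert_surj n (q : {perm letter n.+1}) : q \in signed_perms n.+1 ->
  exists p k b, p \in signed_perms n /\ q = insert p k b.
Proof.
move=> /signed_permP sq.
(* [q] sends [(k, b)] to the letter n + 1, hence [(k, false)] to [(ord_max, b)]: the largest letter
   sits at [k] with sign [b]. *)
pose y := (q^-1)%g (ord_max, false); pose k := y.1; pose b := y.2.
have qk c : q (k, c) = (ord_max, b (+) c).
  have qy : q (k, b) = (ord_max, false) by rewrite -surjective_pairing permKV.
  case: (eqVneq c b) => [->|]; first by rewrite qy addbb.
  move=> cb; have -> : c = ~~ b by move: cb; case: (b); case: (c).
  by rewrite sq qy /lneg /= addbN addbb.
(* [del] erases position [k]. Here [unlift] always succeeds: both letters of index [ord_max] are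
   taken at [k], so injectivity of [q] excludes them elsewhere. *)
pose del (x : letter n) : letter n :=
  (odflt x.1 (unlift ord_max (q (lift k x.1, x.2)).1), (q (lift k x.1, x.2)).2).
have delE x : q (lift k x.1, x.2) = (lift ord_max (del x).1, (del x).2).
  rewrite /del; case E: (q _) => [i c] /=.
  case: (unliftP ord_max i) => [j|] ei; first by rewrite /= ei.
  have : q (lift k x.1, x.2) = q (k, b (+) c) by rewrite E qk addKb ei.
  by move/perm_inj => /pair_equal_spec[/eqP]; rewrite eq_sym (negPf (neq_lift _ _)).
have del_inj : injective del.
  move=> [j c] [j' c'] e; have := delE (j, c); rewrite e -delE.
  by move/perm_inj => /= /pair_equal_spec[/lift_inj -> ->].
exists (perm del_inj), k, b; split.
  apply/signed_permP => i c; rewrite !permE.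
  have := sq (lift k i) c; rewrite (delE (i, c)) (delE (i, ~~ c)) /lneg.
  move=> /pair_equal_spec[/lift_inj /= e1 e2].
  by apply/eqP; rewrite -pair_eqE /= /pair_eq e1 e2 !eqxx.
apply/permP => -[i c]; case: (unliftP k i) => [j|] ->; last by rewrite qk insert_at.
by rewrite insert_lift permE -delE.
Qed.

Lemma sum_signed_insert (R : nmodType) n (F : {perm letter n.+1} -> R) :
  \sum_(q in signed_perms n.+1) F q =
  \sum_(p in signed_perms n) \sum_k \sum_b F (insert p k b).
Proof.
under [RHS]eq_bigr do rewrite pair_bigA /=.
rewrite pair_big_dep /=.
pose ins (x : {perm letter n} * ('I_n.+1 * bool)) := insert x.1 x.2.1 x.2.2.
have ins_inj : injective ins.
  move=> [p [k b]] [p' [k' b']] e.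
  by have [-> -> ->] := @insert_inj n (p, k, b) (p', k', b') e.
rewrite [LHS](_ : _ = \sum_(q in ins @: [pred x | x.1 \in signed_perms n]) F q).
  rewrite big_imset; first by apply: eq_bigl => x; rewrite !inE andbT.
  by move=> x y _ _; apply: ins_inj.
apply: eq_bigl => q; apply/idP/imsetP => [/insert_surj[p [k [b [sp ->]]]] | [x]].
  by exists (p, (k, b)).
by rewrite inE => sp ->; apply: insert_signed.
Qed.

(** * Entries after an insertion *)

Lemma entry1_insert_at n (p : {perm letter n}) k b :
  entry1 (insert p k b) k = if b then - n.+1%:Z else n.+1%:Z.
Proof. by rewrite entry1E insert_at addbF. Qed.

Lemma entry1_insert_lift n (p : {perm letter n}) k b j :
  entry1 (insert p k b) (lift k j) = entry1 p j.
Proof. by rewrite !entry1E insert_lift lval_lift_max. Qed.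

Lemma entry0_insert_at n (p : {perm letter n}) k b :
  entry0 (insert p k b) k = entry p k.
Proof.
rewrite /entry0; case: k => [[|k] hk]; first by rewrite !entry_ord0.
rewrite (@entryS _ p _ (Ordinal (hk : (k < n)%N))) //.
rewrite (@entryS _ _ _ (Ordinal (ltnW hk))) //.
rewrite -(entry1_insert_lift p (Ordinal hk) b); congr entry1.
by apply: val_inj; rewrite /= /bump ltnn.
Qed.

(** Only the old letter at position [k], pushed one step to the right, gets a new left neighbour:
    the inserted letter. *)
Lemma entry0_insert_lift n (p : {perm letter n}) k b (j : 'I_n) :
  entry0 (insert p k b) (lift k j) =
  if j == k :> nat then (if b then - n.+1%:Z else n.+1%:Z) else entry0 p j.
Proof.
rewrite /entry0; case: eqP => [jk|/eqP jk].
  rewrite -(entry1_insert_at p k b); apply: entryS.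
  by rewrite /= /bump -jk leqnn.
case: (ltnP j k) => [ltjk|lekj].
  case: j jk ltjk => [[|j] hj] jk ltjk.
    by rewrite !entry_ord0 //= /bump leqNgt ltjk.
  rewrite (@entryS _ p _ (Ordinal (ltnW hj))) //.
  rewrite -(entry1_insert_lift p k b); apply: entryS.
  by move: ltjk; rewrite /= /bump; lia.
case: j jk lekj => [[|j] hj] jk lekj; first by move: jk lekj => /=; lia.
rewrite (@entryS _ p _ (Ordinal (ltnW hj))) //.
rewrite -(entry1_insert_lift p k b); apply: entryS.
by move: jk lekj; rewrite /= /bump; lia.
Qed.

(** * Effect of an insertion on [inv_B] *)

Lemma card_set_sum (T : finType) (P : pred T) : #|[set x | P x]| = (\sum_x P x)%N.
Proof. by rewrite cardsE -sum1_card big_mkcond. Qed.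

Lemma sum_ord_pairs_lift n (k : 'I_n.+1) (G : 'I_n.+1 -> 'I_n.+1 -> nat) :
  (\sum_(x : 'I_n.+1 * 'I_n.+1) G x.1 x.2 =
   G k k + \sum_j G k (lift k j) + \sum_i G (lift k i) k
   + \sum_(x : 'I_n * 'I_n) G (lift k x.1) (lift k x.2))%N.
Proof.
rewrite -(pair_bigA _ (fun i j => G i j)) (bigD1_ord k) //=.
rewrite (bigD1_ord k) //= -(pair_bigA _ (fun i j => G (lift k i) (lift k j))) /=.
rewrite -[RHS]addnA -big_split /=; congr (_ + _)%N.
by apply: eq_bigr => i _; rewrite (bigD1_ord k).
Qed.

Lemma ltn_lift n (k : 'I_n.+1) (i j : 'I_n) :
  (lift k i < lift k j)%N = (i < j)%N.
Proof. by rewrite ltnNge leq_bump2 -ltnNge. Qed.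

Lemma lift_ltn n (k : 'I_n.+1) (i : 'I_n) : (lift k i < k)%N = (i < k)%N.
Proof. by rewrite /= /bump; case: leqP => ?; lia. Qed.

Lemma ltn_lift_at n (k : 'I_n.+1) (j : 'I_n) : (k < lift k j)%N = (k <= j)%N.
Proof. by rewrite /= /bump; case: leqP => ?; lia. Qed.

(** A letter to the right of the new one adds 1 to exactly one of the two pair counts, whatever the
    sign. A letter to the left adds 1 to both if the new one is negative and to neither otherwise,
    hence the doubled term. The summand [b] counts the new negative entry. *)
Lemma inv_B_insert n (p : {perm letter n}) k b :
  (inv_B (insert p k b) =
   inv_B p + \sum_(j < n) (k <= j) + b + (\sum_(j < n) ((j < k) && b)).*2)%N.
Proof.
have bd j : - n.+1%:Z < entry1 p j < n.+1%:Z by apply: entry_bound.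
have eL j : entry1 (insert p k b) (lift k j) = entry1 p j.
  exact: entry1_insert_lift.
have := entry1_insert_at p k b; rewrite /inv_B !card_set_sum.
move: (entry1 (insert p k b)) eL => e eL ek.
rewrite (sum_ord_pairs_lift k (fun i j => (i < j)%N && (e i > e j))).
rewrite (sum_ord_pairs_lift k (fun i j => (i < j)%N && (- e i > e j))).
rewrite [X in (_ + X)%N = _](bigD1_ord k) //= !ltnn /=.
have E1 : (\sum_(x : 'I_n * 'I_n) ((lift k x.1 < lift k x.2) &&
    (e (lift k x.2) < e (lift k x.1))%R) =
  \sum_(x : 'I_n * 'I_n) ((x.1 < x.2) && (entry1 p x.2 < entry1 p x.1)%R))%N.
  by apply: eq_bigr => x _; rewrite ltn_lift !eL.
have E2 : (\sum_(x : 'I_n * 'I_n) ((lift k x.1 < lift k x.2) &&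
    (e (lift k x.2) < - e (lift k x.1))%R) =
  \sum_(x : 'I_n * 'I_n) ((x.1 < x.2) && (entry1 p x.2 < - entry1 p x.1)%R))%N.
  by apply: eq_bigr => x _; rewrite ltn_lift !eL.
have E3 : (\sum_(i < n) (e (lift k i) < 0)%R = \sum_(i < n) (entry1 p i < 0)%R)%N.
  by apply: eq_bigr => i _; rewrite eL.
have E4 : (\sum_(j < n) ((k < lift k j) && (e (lift k j) < e k)%R) +
    \sum_(j < n) ((k < lift k j) && (e (lift k j) < - e k)%R) =
  \sum_(j < n) (k <= j))%N.
  rewrite -big_split; apply: eq_bigr => j _ /=.
  rewrite ltn_lift_at eL ek.
  by have := bd j; case: (k <= j)%N; case: (b) => /=; lia.
have E5 : (\sum_(i < n) ((lift k i < k) && (e k < e (lift k i))%R) =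
    \sum_(i < n) ((i < k) && b))%N.
  apply: eq_bigr => i _; rewrite lift_ltn eL ek.
  by have := bd i; case: (i < k)%N; case: (b) => /=; lia.
have E6 : (\sum_(i < n) ((lift k i < k) && (e k < - e (lift k i))%R) =
    \sum_(i < n) ((i < k) && b))%N.
  apply: eq_bigr => i _; rewrite lift_ltn eL ek.
  by have := bd i; case: (i < k)%N; case: (b) => /=; lia.
have E7 : (e k < 0) = b by rewrite ek; case: (b); lia.
rewrite E1 E2 E3 E5 E6 E7 -E4 -addnn /=; lia.
Qed.

(** * Effect of an insertion on descents and ascents *)

Lemma sum_insert n (p : {perm letter n}) k b (R : rel int) :
  (\sum_i R (entry0 (insert p k b) i) (entry1 (insert p k b) i) =
   R (entry p k) (if b then - n.+1%:Z else n.+1%:Z) +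
   \sum_(j < n) R (if j == k :> nat then (if b then - n.+1%:Z else n.+1%:Z)
                   else entry0 p j) (entry1 p j))%N.
Proof.
rewrite (bigD1_ord k) //= entry0_insert_at entry1_insert_at; congr (_ + _)%N.
by apply: eq_bigr => j _; rewrite entry0_insert_lift entry1_insert_lift.
Qed.

Lemma sum_insert_max n (p : {perm letter n}) b (R : rel int) :
  (\sum_i R (entry0 (insert p ord_max b) i) (entry1 (insert p ord_max b) i) =
   R (entry p ord_max) (if b then - n.+1%:Z else n.+1%:Z) +
   \sum_(j < n) R (entry0 p j) (entry1 p j))%N.
Proof.
rewrite sum_insert; congr (_ + _)%N; apply: eq_bigr => j _.
by rewrite ltn_eqF.
Qed.

(** The adjacent pair that the insertion breaks up is added on the left, which avoids a subtraction
    in [nat]. *)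
Lemma sum_insert_widen n (p : {perm letter n}) (j : 'I_n) b (R : rel int) :
  (\sum_i R (entry0 (insert p (widen_ord (leqnSn n) j) b) i)
            (entry1 (insert p (widen_ord (leqnSn n) j) b) i)
     + R (entry0 p j) (entry1 p j) =
   R (entry0 p j) (if b then - n.+1%:Z else n.+1%:Z) +
   R (if b then - n.+1%:Z else n.+1%:Z) (entry1 p j) +
   \sum_(i < n) R (entry0 p i) (entry1 p i))%N.
Proof.
rewrite sum_insert (bigD1 j) //= eqxx [in RHS](bigD1 j) //=.
rewrite (eq_bigr (fun i => R (entry0 p i) (entry1 p i) : nat)) => [|i ij].
  by rewrite /entry0 /=; lia.
by rewrite ifN.
Qed.

Definition weight n (p : {perm letter n}) : {mpoly int[2]} :=
  var_t ^+ des_B p * var_s ^+ asc_B p.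

Lemma des_BE n (p : {perm letter n}) :
  des_B p = (\sum_i (entry0 p i > entry1 p i)%R)%N.
Proof. exact: card_set_sum. Qed.

Lemma asc_BE n (p : {perm letter n}) :
  asc_B p = (\sum_i (entry0 p i < entry1 p i)%R)%N.
Proof. exact: card_set_sum. Qed.

Lemma weight_insert_max n (p : {perm letter n}) b :
  weight (insert p ord_max b) = (if b then var_t else var_s) * weight p.
Proof.
have /andP[lb ub] := entry_bound p ord_max.
have D := sum_insert_max p b (fun x y => y < x).
have A := sum_insert_max p b (fun x y => x < y).
rewrite /weight !des_BE !asc_BE {}D {}A; case: b.
  by rewrite lb (lt_gtF lb) add0n add1n exprS mulrA.
by rewrite ub (lt_gtF ub) add0n add1n exprS mulrCA.
Qed.

(** The new letter is extreme, so its two adjacent pairs are one ascent and one descent. Breaking a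
    descent thus gains an ascent on balance, and breaking an ascent gains a descent. *)
Lemma weight_insert_widen n (p : {perm letter n}) (j : 'I_n) b :
  weight (insert p (widen_ord (leqnSn n) j) b) =
  if entry1 p j < entry0 p j then var_s * weight p else var_t * weight p.
Proof.
have /andP[lb0 ub0] : - n.+1%:Z < entry0 p j < n.+1%:Z by apply: entry_bound.
have /andP[lb1 ub1] : - n.+1%:Z < entry1 p j < n.+1%:Z by apply: entry_bound.
have D := sum_insert_widen p j b (fun x y => y < x).
have A := sum_insert_widen p j b (fun x y => x < y).
have vd : (((if b then - n.+1%:Z else n.+1%:Z) < entry0 p j)%R +
  (entry1 p j < (if b then - n.+1%:Z else n.+1%:Z))%R = 1)%N by case: (b); lia.
have va : ((entry0 p j < (if b then - n.+1%:Z else n.+1%:Z))%R +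
  ((if b then - n.+1%:Z else n.+1%:Z) < entry1 p j)%R = 1)%N by case: (b); lia.
move: D A; rewrite vd va -!des_BE -!asc_BE /weight.
have := entry0_neq_entry1 p j; case: ltgtP => //= _ _.
  by rewrite !add1n addn1 addn0 => -[->] ->; rewrite exprS mulrCA.
by rewrite !add1n addn1 addn0 => -> [->]; rewrite exprS mulrA.
Qed.

(** * The operator D on monomials *)

Lemma mderiv_exp (n : nat) (i : 'I_n) (d : nat) :
  mderiv i ('X_i ^+ d : {mpoly int[n]}) = 'X_i ^+ d.-1 *+ d.
Proof.
rewrite mpolyXn mderivX mulmnE mnm1E eqxx mul1n scaler_nat.
case: d => [|d]; first by rewrite !mulr0n.
congr (_ *+ _); rewrite /= mpolyXn; congr mpolyX; apply/mnmP => j.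
by rewrite mnmBE !mulmnE mulnS addKn.
Qed.

Lemma mderiv_exp_neq (n : nat) (i k : 'I_n) (d : nat) : i != k ->
  mderiv i ('X_k ^+ d : {mpoly int[n]}) = 0.
Proof.
move=> ik; rewrite mpolyXn mderivX mulmnE mnm1E eq_sym (negPf ik) mul0n.
by rewrite scale0r.
Qed.

Lemma D_st_weight n (p : {perm letter n}) :
  var_s * var_t * D_st (weight p) =
  var_t * weight p *+ asc_B p + var_s * weight p *+ des_B p.
Proof.
rewrite /D_st /weight !mderivM !mderiv_exp !mderiv_exp_neq //.
rewrite mul0r mulr0 add0r addr0.
(* The exponents [d.-1] and [a.-1] are genuine predecessors only for positive exponents; at 0 the
   coefficient vanishes. *)
case: (des_B p) (asc_B p) => [|d] [|a] /=;
  rewrite ?exprS; ring.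
Qed.

(** The sign may vary with the position, since a prescribed parity of [inv_B] dictates it position
    by position. *)
Lemma sum_weight_insert_widen n (p : {perm letter n}) (b : 'I_n -> bool) :
  \sum_j weight (insert p (widen_ord (leqnSn n) j) (b j)) =
  var_s * var_t * D_st (weight p).
Proof.
rewrite D_st_weight des_BE asc_BE -!sumrMnr -big_split /=; apply: eq_bigr => j _.
rewrite weight_insert_widen; have := entry0_neq_entry1 p j.
by case: ltgtP => //= _ _; rewrite ?mulr1n ?mulr0n ?add0r ?addr0.
Qed.

(** * The recurrence for a prescribed parity *)

Definition parity_gf n (c : bool) : {mpoly int[2]} :=
  \sum_(p in signed_perms n | odd (inv_B p) == c) weight p.

Lemma D_st_sum (I : finType) (P : pred I) F :
  D_st (\sum_(i | P i) F i) = \sum_(i | P i) D_st (F i).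
Proof. by rewrite /D_st !raddf_sum -big_split. Qed.

Lemma parity_gfS n c :
  parity_gf n.+1 c = var_s * parity_gf n c + var_t * parity_gf n (~~ c)
                     + var_s * var_t * D_st (B_poly n).
Proof.
have -> : B_poly n = \sum_(p in signed_perms n) weight p by [].
rewrite D_st_sum.
rewrite /parity_gf big_mkcondr sum_signed_insert /=.
(* The parity of the number of letters to the right of the insertion point. *)
pose r k := odd (\sum_(j < n) (k <= j)).
have oddE (p : {perm letter n}) k b : odd (inv_B (insert p k b)) = odd (inv_B p) (+) r k (+) b.
  by rewrite inv_B_insert 3!oddD odd_double addbF oddb.
(* Exactly one of the two signs gives the required parity. *)
have bE (p : {perm letter n}) k :
    \sum_b (if odd (inv_B (insert p k b)) == c then weight (insert p k b) else 0)
    = weight (insert p k (c (+) (odd (inv_B p) (+) r k))).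
  rewrite big_bool /= !oddE; by case: (_ (+) r k); case: (c); rewrite ?addr0 ?add0r.
under eq_bigr => p sp.
  under eq_bigr do rewrite bE.
  (* The last position is split off; the others together give the term with D. *)
  rewrite big_ord_recr /= sum_weight_insert_widen; over.
rewrite big_split /= -mulr_sumr addrC; congr (_ + _).
(* At the end the forced sign is therefore [c (+) odd (inv_B p)]: positive, with factor s, if [p]
   has parity [c], and negative, with factor t, otherwise. *)
have rmax : r n = false by rewrite /r big1 // => j _; rewrite leqNgt ltn_ord.
rewrite !mulr_sumr !big_mkcondr -big_split /=; apply: eq_bigr => p _.
rewrite weight_insert_max rmax addbF.
by case: (odd _); case: (c) => /=; rewrite ?addr0 ?add0r.
Qed.

Lemma B_plusE n : B_plus n = parity_gf n false.
Proof. by apply: eq_bigl => p; rewrite inE eqbF_neg. Qed.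

Lemma B_minusE n : B_minus n = parity_gf n true.
Proof.
apply: eq_bigl => p; rewrite !inE.
by case: [forall _, _]; case: (odd _).
Qed.

Theorem theorem28 (n : nat) (hn : (2 <= n)%N) :
  B_plus n = var_s * B_plus n.-1 + var_t * B_minus n.-1
             + var_s * var_t * D_st (B_poly n.-1)
  /\
  B_minus n = var_s * B_minus n.-1 + var_t * B_plus n.-1
              + var_s * var_t * D_st (B_poly n.-1).
Proof.
case: n hn => // n _; rewrite !B_plusE !B_minusE.
by split; apply: parity_gfS.
Qed.
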